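(* Let $\mathcal{I}$ be a nontrivial admissible ideal of subsets of $\mathbb{N}$. Let $H\subset\mathbb{R}$ be an $F_\sigma$ set (in the usual topology of $\mathbb{R}$) such that $\mathcal{I}\text{-}d(x,H)=1$ for all $x\in H$. Then there exists a function $g:\mathbb{R}\to\mathbb{R}$ that is $\mathcal{I}$-approximately continuous (at every point of $\mathbb{R}$) such that (1) $0<g(x)\le 1$ for $x\in H$, and (2) $g(x)=0$ for $x\notin H$.
   Context: $m$ denotes Lebesgue measure on $\mathbb{R}$. An ideal $\mathcal{I}$ of subsets of $\mathbb{N}=\{1,2,\dots\}$ is a nonempty family closed under finite unions and under subsets; it is nontrivial if $\mathcal{I}\neq\{\emptyset\}$ and $\mathbb{N}\notin\mathcal{I}$, and admissible if it contains all singletons. $\mathcal{F}(\mathcal{I})=\{M\subset\mathbb{N}:\mathbb{N}\setminus M\in\mathcal{I}\}$. For a bounded real sequence $x=(x_n)$: $\mathcal{I}\text{-}\limsup x=\sup\{b\in\mathbb{R}:\{k:x_k>b\}\notin\mathcal{I}\}$ and $\mathcal{I}\text{-}\liminf x=\inf\{a\in\mathbb{R}:\{k:x_k<a\}\notin\mathcal{I}\}$. Let $E\subset\mathbb{R}$ be Lebesgue measurable and $p\in\mathbb{R}$. Consider sequences $(J_n)_{n\in\mathbb{N}}$ of closed intervals with $p\in J_n$ for all $n$ and $\{n\in\mathbb{N}:0<m(J_n)<\frac1n\}\in\mathcal{F}(\mathcal{I})$. For such a sequence put $x_n=\frac{m(J_n\cap E)}{m(J_n)}$ (with $x_n:=0$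 if $m(J_n)\in\{0,\infty\}$; such $n$ form a set in $\mathcal{I}$ and do not matter). The upper $\mathcal{I}$-density $\mathcal{I}\text{-}d^-(p,E)$ is the supremum of $\mathcal{I}\text{-}\limsup x_n$ over all such sequences $(J_n)$, and the lower $\mathcal{I}$-density $\mathcal{I}\text{-}d_-(p,E)$ is the infimum of $\mathcal{I}\text{-}\liminf x_n$ over all such sequences. If they are equal, the common value is the $\mathcal{I}$-density $\mathcal{I}\text{-}d(p,E)$; ''$\mathcal{I}\text{-}d(p,E)=1$'' means it exists and equals $1$. A function $f:\mathbb{R}\to\mathbb{R}$ is $\mathcal{I}$-approximately continuous at $x_0$ if there is a Lebesgue measurable set $E_{x_0}$ (containing $x_0$) such that $\mathcal{I}\text{-}d(x_0,E_{x_0})=1$ and $f|_{E_{x_0}}$ is continuous at $x_0$. *)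

(* Defs.v *)
From HB Require Import structures.
From mathcomp Require Import all_boot all_order all_algebra.
From mathcomp Require Import all_classical all_reals all_analysis.
From mathcomp Require Import borel_hierarchy.
Set Implicit Arguments.
Unset Strict Implicit.
Unset Printing Implicit Defensive.
Import Order.TTheory GRing.Theory Num.Theory.
Import numFieldNormedType.Exports.
Local Open Scope classical_set_scope.
Local Open Scope ring_scope.

(* The index set {1, 2, ...} is represented by [nat], with [n : nat] standing
   for the positive integer [n.+1]. *)

Definition is_ideal (I : set (set nat)) : Prop :=
  [/\ I !=set0,
      forall A B, I A -> I B -> I (A `|` B) &
      forall A B, A `<=` B -> I B -> I A].

Definition nontrivial_ideal (I : set (set nat)) : Prop :=
  I <> [set set0] /\ ~ I setT.

Definition admissible_ideal (I : set (set nat)) : Prop :=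
  forall n, I [set n].

Definition dual_filter (I : set (set nat)) : set (set nat) :=
  [set M | I (~` M)].

(* These are only used for bounded sequences and nontrivial ideals, for which
   the real-valued [sup] and [inf] are the genuine ones. *)
Definition ideal_limsup (R : realType) (I : set (set nat)) (x : nat -> R) : R :=
  sup [set b : R | ~ I [set k | b < x k]].

Definition ideal_liminf (R : realType) (I : set (set nat)) (x : nat -> R) : R :=
  inf [set a : R | ~ I [set k | x k < a]].

(* [measurable] on [R] is the Borel sigma-algebra; the Lebesgue sigma-algebra
   is that of the Caratheodory-measurable sets of the outer measure generated
   by interval length, the domain of [completed_lebesgue_measure]. *)
Definition lebesgue_measurable (R : realType) (E : set R) : Prop :=
  ((wlength (@idfun R))^*%mu.-cara.-measurable) E.

Definition leb (R : realType) (E : set R) : \bar R :=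
  completed_lebesgue_measure E.

(* Degenerate and unbounded intervals are allowed. *)
Definition closed_interval (R : realType) (J : set R) : Prop :=
  closed J /\ is_interval J.

Definition shrinking_at (R : realType) (I : set (set nat)) (p : R)
    (J : nat -> set R) : Prop :=
  [/\ forall n, closed_interval (J n),
      forall n, J n p &
      dual_filter I [set n | (0 < leb (J n) < (n.+1%:R^-1)%:E)%E]].

(* Since [fine +oo = 0] and [0^-1 = 0], this is [0] when the measure of [J n]
   is [0] or [+oo]. *)
Definition density_ratio (R : realType) (E : set R) (J : nat -> set R)
    (n : nat) : R :=
  fine (leb (J n `&` E)) / fine (leb (J n)).

Definition upper_density (R : realType) (I : set (set nat)) (p : R)
    (E : set R) : R :=
  sup [set ideal_limsup I (density_ratio E J) | J in shrinking_at I p].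

Definition lower_density (R : realType) (I : set (set nat)) (p : R)
    (E : set R) : R :=
  inf [set ideal_liminf I (density_ratio E J) | J in shrinking_at I p].

Definition has_density (R : realType) (I : set (set nat)) (p : R)
    (E : set R) (d : R) : Prop :=
  upper_density I p E = d /\ lower_density I p E = d.

Definition ideal_approx_continuous_at (R : realType) (I : set (set nat))
    (f : R -> R) (x0 : R) : Prop :=
  exists E : set R,
    [/\ lebesgue_measurable E, E x0, has_density I x0 E 1 &
        f x @[x --> within E (nbhs x0)] --> f x0].

(* Main.v *)
Require Import Defs.
From HB Require Import structures.
From mathcomp Require Import all_boot all_order all_algebra.
From mathcomp Require Import all_classical all_reals all_analysis.
From mathcomp Require Import borel_hierarchy.
From mathcomp Require Import measurable_realfun ring lra.
Set Implicit Arguments.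
Unset Strict Implicit.
Unset Printing Implicit Defensive.
Import Order.TTheory GRing.Theory Num.Theory.
Import numFieldNormedType.Exports.
Local Open Scope classical_set_scope.
Local Open Scope ring_scope.

(** Although it is phrased with ideals, density one at a point is the classical
    notion.  If [E] leaves out a fixed proportion of arbitrarily short intervals
    around [p], then a sequence of such intervals competes in the infimum that
    defines the lower density, whatever the ideal is, and brings it below one.
    Conversely, at a classical density point the ratios come close to one along
    every competing sequence, up to a set of indices in the ideal
    ([has_density_density_point], [density_point_has_density]).  The statement thus reduces to Zahorski's
    theorem on approximately continuous functions.

    Say that [A] is density-contained in [B] when [A] is a subset of [B] and
    every point of [A] is a density point of [B].  The proof imitates
    Urysohn's construction with this relation in the role of the inclusion of
    a closed set in an open one.  Its normality property is the Lusin-Menchoff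
    theorem ([lusin_menchoff]): a closed set density-contained in a Borel set
    is density-contained in some closed subset of it.  Together with
    Lebesgue's density theorem it inserts a closed set between two closed sets,
    one density-contained in the other, with density-containment on both sides
    ([density_interpolation]).  So [H], being an F-sigma, is the
    union of closed sets [C 0 k] each density-contained in the next
    ([density_exhaustion]), and repeated insertion gives closed sets [C m k],
    indexed by the dyadic rationals [k / 2 ^+ m] and density-contained in one
    another in that order.

    Let [g x] be the supremum of [1 / (1 + k / 2 ^+ m)] over the sets [C m k]
    that contain [x], and zero when there are none.  As the sets are closed,
    [g] is upper semicontinuous; so it is continuous at every point outside
    [H], where it reaches its least value zero.  If [x] is in [H] and
    [u < g x], two of the values lie between [u] and [g x], and the
    density-containment of the corresponding sets makes [x] a density point of
    a set on which [g > u].  A diagonal argument merges these sets, as [u]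
    tends to [g x], into a single one along which [g] is continuous at [x]
    ([density_point_diagonal]). *)

(** * Lebesgue measure of Borel sets *)

Lemma le_lebesgue (R : realType) (A B : set R) :
  measurable A -> measurable B -> A `<=` B ->
  (lebesgue_measure A <= lebesgue_measure B)%E.
Proof. by move=> mA mB AB; rewrite le_measure ?inE. Qed.

#[local] Hint Extern 0 (measurable (ball _ _)) => exact: measurable_ball : core.

Lemma lebesgue_split (R : realType) (J A : set R) :
  measurable J -> measurable A -> (lebesgue_measure J < +oo)%E ->
  [/\ lebesgue_measure (J `\` A) \is a fin_num,
      lebesgue_measure (J `&` A) \is a fin_num &
      fine (lebesgue_measure J) = fine (lebesgue_measure (J `\` A)) +
                                  fine (lebesgue_measure (J `&` A))].
Proof.
move=> mJ mA Jfin.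
have fin B : measurable B -> B `<=` J -> lebesgue_measure B \is a fin_num.
  by move=> mB BJ; rewrite ge0_fin_numE// (le_lt_trans _ Jfin)//; exact: le_lebesgue.
have Dfin : lebesgue_measure (J `\` A) \is a fin_num.
  by apply: fin => //; exact: measurableD.
have Ifin : lebesgue_measure (J `&` A) \is a fin_num.
  by apply: fin => //; exact: measurableI.
split => //; rewrite -fineD//; congr fine.
exact: measureDI.
Qed.

Lemma measure_bigcup_dyadic (R : realType) (B : nat -> set R) (c : R) :
  (forall n, measurable (B n)) -> 0 <= c ->
  (forall n, (lebesgue_measure (B n) <= (c / 2 ^+ n.+1)%:E)%E) ->
  (lebesgue_measure (\bigcup_n B n) <= c%:E)%E.
Proof.
move=> mB c0 hB.
have mU : measurable (\bigcup_n B n) by exact: bigcupT_measurable.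
apply: (le_trans (measure_sigma_subadditive lebesgue_measure mB mU (@subset_refl _ _))).
apply: (le_trans _ (epsilon_trick0 xpredT c0)).
apply: lee_nneseries => [n _ _|n _]; first exact: measure_ge0.
by rewrite natrX; exact: hB.
Qed.

(** * The Lusin-Menchoff theorem *)

(** Symmetric balls are enough: an interval of length [l] around [x] lies in
    [ball x (l *+ 2)], so a bound on the part of balls outside [E] bounds the
    part of all short intervals around [x], one-sided ones included. *)
Definition density_point {R : realType} (E : set R) (x : R) : Prop :=
  forall e : R, 0 < e ->
    \forall r \near 0^'+, (lebesgue_measure (ball x r `\` E) <= (e * r)%:E)%E.

Lemma exists_half_expr_lt (R : realType) (e : R) :
  0 < e -> exists n, 2^-1 ^+ n < e.
Proof.
move=> e0; have /cvgrPdist_lt/(_ e e0) : (2^-1 : R) ^+ n @[n --> \oo] --> (0 : R).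
  by apply: cvg_expr; rewrite ger0_norm; lra.
move=> [n _ /(_ n (leqnn n))] /=.
by rewrite sub0r normrN ger0_norm ?exprn_ge0 ?invr_ge0// => ?; exists n.
Qed.

Lemma closure_thickening_closed (R : realType) (X : set R) (y : R) :
  closed X -> (forall k, closure (\bigcup_(x in X) ball x (2^-1 ^+ k)) y) -> X y.
Proof.
move=> cX hy; apply: cX => B /nbhs_ballP[e /= e0 eB].
have e2 : 0 < e / 2 by lra.
have [k ke] := exists_half_expr_lt e2.
have [z [[x Xx xz] yz]] := hy k _ (nbhsx_ballx y _ e2).
exists x; split => //; apply: eB.
rewrite (splitr e); apply: (ball_triangle yz); apply: ball_sym.
exact: le_ball (ltW ke) _ xz.
Qed.

(** Near [X] the set [Q] has to be almost as large as [M], while away from [X] it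
    only has to be closed.  So [Q] is the intersection over [k] of
    [T k `|` K k], where [T k] is the closed [2^-k]-neighbourhood of [X] and [K k]
    is a compact subset of [M] which exhausts the bounded part [N k] of [M] up to
    [8^-k / 2].  A point of all the [T k] is in [X]; any other point of [Q] is in
    some [K k], hence in [M].  A ball of radius [r] around a point of [X] is
    contained in [T k] as long as [r <= 2^-k], so what [Q] misses of [M] in this
    ball has measure at most the sum of the errors [8^-k / 2] with [2^-k < r],
    which is of order [r ^+ 2]. *)
Lemma lusin_menchoff (R : realType) (X M : set R) :
  closed X -> measurable M -> X `<=` M ->
  (forall x, X x -> density_point M x) ->
  exists Q, [/\ closed Q, X `<=` Q, Q `<=` M &
    forall x, X x -> density_point Q x].
Proof.
move=> cX mM XM dM.
pose T k := closure (\bigcup_(x in X) ball x (2^-1 ^+ k)).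
pose N k := M `&` ball (0 : R) k%:R.
have mN k : measurable (N k) by apply: measurableI => //; exact: measurable_ball.
have /choice[K KP] k : exists K : set R, [/\ compact K, K `<=` N k &
    (lebesgue_measure (N k `\` K) < (8^-1 ^+ k / 2)%:E)%E].
  apply: lebesgue_regularity_inner => //.
  apply: (@le_lt_trans _ _ (lebesgue_measure (ball (0:R) k%:R))).
    by apply: le_lebesgue => //; exact: subIsetr.
  by rewrite lebesgue_measure_ball ?ltry.
have cK k : closed (K k) by have [cp _ _] := KP k; exact: compact_closed.
pose Q := \bigcap_k (T k `|` K k).
have XT k : X `<=` T k.
  move=> x Xx; apply: subset_closure; exists x => //; apply: ballxx.
  by rewrite exprn_gt0 ?invr_gt0.
exists Q; split.
- apply: closed_bigI => k _; apply: closedU => //; exact: closed_closure.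
- by move=> x Xx k _; left; exact: XT.
- move=> y Qy; have [yT|/existsNP[k ky]] := pselect (forall k, T k y).
    by apply: XM; apply: closure_thickening_closed yT.
  have [//|] := Qy k I; have [_ KN _] := KP k; by move=> /KN[].
move=> x Xx e e0.
have [k0 xk0] : exists k0 : nat, `|x| + 1 <= k0%:R.
  exists (Num.bound (`|x| + 1)); apply: ltW.
  by apply: archi_boundP; rewrite addr_ge0.
have e20 : 0 < e / 2 by lra.
near=> r.
have r0 : 0 < r by [].
pose B k := (ball x r `&` (N k `\` K k)) `\` T k.
have mB k : measurable (B k).
  apply: measurableD; last by apply: closed_measurable; exact: closed_closure.
  apply: measurableI; first exact: measurable_ball.
  by apply: measurableD => //; exact: closed_measurable.
have sub : ball x r `\` Q `<=` (ball x r `\` M) `|` \bigcup_k B k.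
  move=> y [xy nQ]; have [My|] := pselect (M y); last by left.
  right; move/existsNP : nQ => [k /not_implyP[_ /not_orP[nT nK]]].
  exists k => //; split => //; split => //; split => //; split => //.
  (* [y] is in [N k]: if it is not in [T k], then [k] is at least [k0], so
     that the truncation at radius [k] spares the whole ball. *)
  rewrite /ball /= sub0r normrN.
  have kk0 : (k0 <= k)%N.
    rewrite leqNgt; apply/negP => kk0; apply: nT; apply: subset_closure.
    exists x => //; apply: le_ball xy.
    apply: (@le_trans _ _ (2^-1 ^+ k0)).
      by near: r; apply: nbhs_right_le; rewrite exprn_gt0 ?invr_gt0.
    by rewrite ler_wiXn2l ?(ltnW kk0)//; lra.
  have : `|x - y| < 1 by rewrite (lt_le_trans xy)//; near: r; exact: nbhs_right_le.
  have : k0%:R <= k%:R :> R by rewrite ler_nat.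
  by have := ler_distD x 0 y; rewrite !sub0r !normrN; lra.
have -> : e * r = e / 2 * r + e / 2 * r by lra.
rewrite EFinD.
apply: (@le_trans _ _ (lebesgue_measure ((ball x r `\` M) `|` \bigcup_k B k))).
  apply: le_lebesgue sub.
  - apply: measurableD; first exact: measurable_ball.
    apply: bigcapT_measurable => k; apply: measurableU; apply: closed_measurable => //.
    exact: closed_closure.
  - apply: measurableU; first by apply: measurableD => //; exact: measurable_ball.
    exact: bigcupT_measurable.
apply: (le_trans (measureU2 _ _ _)).
- by apply: measurableD => //; exact: measurable_ball.
- exact: bigcupT_measurable.
apply: leeD.
  by near: r; exact: dM.
apply: (@le_trans _ _ (r ^+ 2)%:E); last first.
  rewrite lee_fin expr2 ler_wpM2r ?ltW//; near: r; exact: nbhs_right_lt.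
apply: measure_bigcup_dyadic => //; first exact: sqr_ge0.
move=> k.
have [rk|rk] := leP r (2^-1 ^+ k).
  rewrite (_ : B k = set0) ?measure0.
    by rewrite lee_fin divr_ge0 ?sqr_ge0// exprn_ge0.
  rewrite -subset0 => y [[xy _] nT]; apply: nT; apply: subset_closure.
  by exists x => //; apply: le_ball xy.
have [_ _ /ltW Kk] := KP k.
apply: (@le_trans _ _ (lebesgue_measure (N k `\` K k))).
  apply: le_lebesgue => //; last by move=> y [[]].
  by apply: measurableD => //; exact: closed_measurable.
apply: (le_trans Kk); rewrite lee_fin.
have q0 : 0 <= 2^-1 ^+ k :> R by rewrite exprn_ge0// invr_ge0.
have -> : 8^-1 ^+ k / 2 = (2^-1 ^+ k) ^+ 2 / 2 ^+ k.+1 :> R.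
  rewrite -(exprVn 2 k.+1) (exprS _ k) mulrCA mulrC; congr (_ * _).
  by rewrite -exprM mulnC exprM -exprMn; congr (_ ^+ k); field.
rewrite ler_wpM2r ?invr_ge0 ?exprn_ge0//.
by rewrite ler_pXn2r// ?nnegrE ltW.
Unshelve. all: by end_near. Qed.

(** * Density points *)

Lemma ae_density_point (R : realType) (A : set R) : measurable A ->
  exists N : set R, [/\ measurable N, lebesgue_measure N = 0%E &
    forall x, A x -> ~ N x -> density_point A x].
Proof.
move=> mA; have [N [mN N0 AN]] := lebesgue_density mA.
exists N; split => // x Ax nNx e e0.
have {nNx} : ~ ~ (lebesgue_measure (A `&` ball x r) / lebesgue_measure (ball x r))%E
    @[r --> 0^'+] --> (\1_A x)%:E by move=> nx; apply: nNx; exact: AN.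
move/contrapT; rewrite indicE mem_set// => /fine_cvgP[_].
have e1 : 1 - e / 2 < 1 :> R by lra.
move=> /cvgr_gt/(_ _ e1) /= Ar; near=> r.
have r0 : 0 < r by [].
have mur : lebesgue_measure (ball x r) = (r *+ 2)%:E.
  by rewrite lebesgue_measure_ball// ltW.
have murfin : (lebesgue_measure (ball x r) < +oo)%E by rewrite mur ltry.
have [Dfin Afin DI] := lebesgue_split (measurable_ball x r) mA murfin.
have : 1 - e / 2 < fine (lebesgue_measure (A `&` ball x r) /
    lebesgue_measure (ball x r))%E by near: r.
move: DI; rewrite [A `&` ball x r]setIC -(fineK Afin) -(fineK Dfin) mur inver mulrn_eq0/= gt_eqF//= lee_fin.
rewrite ltr_pdivlMr; last lra.
nra.
Unshelve. all: by end_near. Qed.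

(** By Lebesgue's theorem the density points of [P] exhaust it up to a null set [N],
    so the Lusin-Menchoff theorem applies to [X] inside the Borel set
    [X `|` (P `\` N)], all of whose points are density points of [P]. *)
Lemma density_interpolation (R : realType) (X P : set R) :
  closed X -> closed P -> X `<=` P ->
  (forall x, X x -> density_point P x) ->
  exists Q, [/\ closed Q, X `<=` Q, Q `<=` P,
    forall x, X x -> density_point Q x & forall x, Q x -> density_point P x].
Proof.
move=> cX cP XP dP; have mP := closed_measurable cP.
have mX := closed_measurable cX.
have [N [mN N0 PN]] := ae_density_point mP.
pose M := X `|` (P `\` N).
have mM : measurable M by apply: measurableU => //; exact: measurableD.
have dM x : X x -> density_point M x.
  move=> Xx e e0; near=> r.
  apply: (@le_trans _ _ (lebesgue_measure ((ball x r `\` P) `|` N))).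
    apply: le_lebesgue.
    - exact: measurableD.
    - by apply: measurableU => //; exact: measurableD.
    - move=> y [xy /not_orP[_ nPN]].
      have [Py|] := pselect (P y); last by left.
      by right; apply: contrapT => nN; exact: nPN.
  apply: (le_trans (measureU2 _ _ _)) => //; first exact: measurableD.
  by rewrite [X in (_ + X)%E]N0 adde0; near: r; exact: dP.
have [Q [cQ XQ QM dQ]] := lusin_menchoff cX mM (@subsetUl _ _ _) dM.
exists Q; split => // x /QM.
- by case=> [/XP|[]].
- by case=> [/dP|[Px nN]] //; exact: PN.
Unshelve. all: by end_near. Qed.

(** [F] is cut out by [E n] only inside [ball x (d n)].  The radius [d n] is so small
    that, at every scale [r], the part removed on account of [E n] has measure at most
    [2^-n / 2^(n+1) * r].  For large [n] these bounds add up to a small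
    fraction of [r], and for the finitely many other [n] it is enough that
    [x] is a density point of [E n]. *)
Lemma density_point_diagonal (R : realType) (E : nat -> set R) (x : R) :
  (forall n, measurable (E n)) -> (forall n, E n x) ->
  (forall n, density_point (E n) x) ->
  exists F : set R, [/\ measurable F, F x, density_point F x &
    forall n, \forall y \near x, F y -> E n y].
Proof.
move=> mE Ex dE.
have /choice[d dP] n : exists d : R, 0 < d /\ forall r, 0 < r -> r <= d ->
    (lebesgue_measure (ball x r `\` E n) <= (2^-1 ^+ n / 2 ^+ n.+1 * r)%:E)%E.
  have c0 : 0 < 2^-1 ^+ n / 2 ^+ n.+1 :> R by rewrite divr_gt0 ?exprn_gt0 ?invr_gt0.
  have [d /= d0 dB] := dE n _ c0.
  exists (d / 2); split; first by rewrite divr_gt0.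
  move=> r r0 rd; apply: dB => //=.
  by rewrite /ball_ /= sub0r normrN gtr0_norm//; lra.
pose F := \bigcap_n (E n `|` ~` ball x (d n)).
have mF : measurable F.
  by apply: bigcapT_measurable => n; apply: measurableU => //; exact: measurableC.
exists F; split => //.
- by move=> n _; left.
- move=> e e0.
  have [n0 n0e] : exists n0 : nat, forall n, (n0 <= n)%N -> 2^-1 ^+ n <= e :> R.
    have [n0 n0e] := exists_half_expr_lt e0; exists n0 => n n0n.
    by rewrite (le_trans _ (ltW n0e))// ler_wiXn2l//; lra.
  have : \forall r \near 0^'+, forall n : 'I_n0,
      (lebesgue_measure (ball x r `\` E n) <= (e / 2 ^+ n.+1 * r)%:E)%E.
    apply: filter_forall => n; apply: dE.
    by rewrite divr_gt0// exprn_gt0.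
  move=> head; near=> r; have r0 : 0 < r by [].
  pose B n := (ball x r `&` ball x (d n)) `\` E n.
  have mB n : measurable (B n) by apply: measurableD => //; exact: measurableI.
  rewrite (_ : ball x r `\` F = \bigcup_n B n); last first.
    apply/seteqP; split => y.
    - move=> [xy /existsNP[n /not_implyP[_ /not_orP[nE /contrapT dn]]]].
      by exists n.
    - by move=> [n _ [[xy xd] nE]]; split => // /(_ n I)[].
  apply: measure_bigcup_dyadic => //; first by rewrite mulr_ge0// ltW.
  move=> n; have -> : e * r / 2 ^+ n.+1 = e / 2 ^+ n.+1 * r by rewrite mulrAC.
  have [nn0|nn0] := ltnP n n0.
    apply: (@le_trans _ _ (lebesgue_measure (ball x r `\` E n))).
      apply: le_lebesgue => //; first exact: measurableD.
      by move=> y [[]].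
    have h : forall n : 'I_n0,
      (lebesgue_measure (ball x r `\` E n) <= (e / 2 ^+ n.+1 * r)%:E)%E by near: r.
    exact: (h (Ordinal nn0)).
  have [dn0 dnP] := dP n.
  apply: (@le_trans _ _ (lebesgue_measure (ball x (Num.min r (d n)) `\` E n))).
    apply: le_lebesgue => //; first exact: measurableD.
    move=> y [[xy xd] nE]; split => //; rewrite /ball/=.
    by rewrite lt_min; apply/andP; split.
  apply: (le_trans (dnP _ _ _)).
  - by rewrite lt_min r0.
  - by rewrite ge_min lexx orbT.
  rewrite lee_fin; apply: ler_pM.
  - by rewrite divr_ge0 ?exprn_ge0 ?invr_ge0.
  - by rewrite le_min !ltW.
  - by rewrite ler_wpM2r ?n0e// invr_ge0 exprn_ge0.
  - by rewrite ge_min lexx.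
- move=> n; have [dn0 _] := dP n.
  near=> y => /(_ n I)[//|]; case; near: y; exact: nbhsx_ballx.
Unshelve. all: by end_near. Qed.

(** * Scales of closed sets *)

Definition density_subset (R : realType) (A B : set R) : Prop :=
  A `<=` B /\ forall x, A x -> density_point B x.

Lemma density_subset_trans (R : realType) (A B C : set R) :
  measurable B -> measurable C ->
  density_subset A B -> density_subset B C -> density_subset A C.
Proof.
move=> mB mC [AB dB] [BC dC]; split; first exact: subset_trans BC.
by move=> x /AB; exact: dC.
Qed.

(** [A n.+1] is obtained from the Lusin-Menchoff theorem applied to the union of [A n]
    and the [n]-th closed piece of [H], inside [H]. *)
Lemma density_exhaustion (R : realType) (H : set R) :
  Fsigma H -> (forall x, H x -> density_point H x) ->
  exists A : nat -> set R, [/\ forall n, closed (A n),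
    forall n, density_subset (A n) (A n.+1) & H = \bigcup_n A n].
Proof.
move=> FH dH.
have [F cF HF] := FH.
have mH : measurable H.
  by rewrite HF; apply: bigcupT_measurable => n; exact: closed_measurable.
have FsubH n : F n `<=` H by rewrite HF => x Fx; exists n.
have next n (X : set R) : exists Y : set R, closed X /\ X `<=` H ->
    [/\ closed Y, Y `<=` H, F n `<=` Y & density_subset X Y].
  have [[cX XH]|nX] := pselect (closed X /\ X `<=` H); last by exists set0.
  have cXF : closed (X `|` F n) by exact: closedU.
  have XFH : X `|` F n `<=` H by move=> x [/XH|/FsubH].
  have [Y [cY XFY YH dY]] := lusin_menchoff cXF mH XFH (fun x Xx => dH x (XFH x Xx)).
  exists Y => _; split => //; first by move=> x Fx; apply: XFY; right.
  by split=> x Xx; [apply: XFY|apply: dY]; left.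
have [Y YP] : exists Y : nat -> set R -> set R, forall n X, closed X /\ X `<=` H ->
    [/\ closed (Y n X), Y n X `<=` H, F n `<=` Y n X & density_subset X (Y n X)].
  have /choice[Y YP] : forall nX : nat * set R, exists Y : set R,
      closed nX.2 /\ nX.2 `<=` H ->
    [/\ closed Y, Y `<=` H, F nX.1 `<=` Y & density_subset nX.2 Y].
    by move=> [n X]; exact: next.
  by exists (fun n X => Y (n, X)) => n X; exact: YP (n, X).
pose A := fix A n := if n is m.+1 then Y m (A m) else set0.
have AP n : closed (A n) /\ A n `<=` H.
  elim: n => [|n IH] /=; first by split; [exact: closed0|].
  by have [] := YP n _ IH.
exists A; split.
- by move=> n; have [] := AP n.
- by move=> n /=; have [] := YP n _ (AP n).
- apply/seteqP; split => [x|x [n _]]; last by have [_] := AP n; exact.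
  rewrite HF => -[n _ Fx]; exists n.+1 => //=.
  by have [_ _ + _] := YP n _ (AP n); exact.
Qed.

(** [C m k] stands for the set attached to the dyadic number [k / 2 ^+ m]. *)
Definition dyadic_scale (R : realType) (C : nat -> nat -> set R) : Prop :=
  [/\ forall m k, closed (C m k), forall m k, C m.+1 k.*2 = C m k &
      forall m k, density_subset (C m k) (C m k.+1)].

Lemma exists_dyadic_scale (R : realType) (H : set R) :
  Fsigma H -> (forall x, H x -> density_point H x) ->
  exists C : nat -> nat -> set R,
    dyadic_scale C /\ H = \bigcup_k C 0 k.
Proof.
move=> FH dH; have [A [cA dA HA]] := density_exhaustion FH dH.
have next (XP : set R * set R) : exists Q : set R,
    [/\ closed XP.1, closed XP.2 & density_subset XP.1 XP.2] ->
    [/\ closed Q, density_subset XP.1 Q & density_subset Q XP.2].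
  have [[cX cP [XP12 dXP]]|n] :=
    pselect [/\ closed XP.1, closed XP.2 & density_subset XP.1 XP.2]; last by exists set0.
  by have [Q [cQ XQ QP dQ dP]] := density_interpolation cX cP XP12 dXP; exists Q.
have {next} [Q QP] := choice next.
pose C := fix C m k : set R := if m is m'.+1 then
  if odd k then Q (C m' k./2, C m' k./2.+1) else C m' k./2 else A k.
have CP m : (forall k, closed (C m k)) /\ forall k, density_subset (C m k) (C m k.+1).
  elim: m => [|m [cC dC]]; first by split.
  have QC k := QP (C m k, C m k.+1) (And3 (cC k) (cC k.+1) (dC k)).
  split => k /=.
    by case: ifP => // _; have [] := QC k./2.
  rewrite uphalf_half; case: (odd k) => /=; first by have [] := QC k./2.
  by rewrite add0n; have [] := QC k./2.
exists C; split => //; split => m k.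
- by have [] := CP m.
- by rewrite /= odd_double half_double.
- by have [] := CP m.
Qed.

Section DyadicScale.
Context {R : realType} {C : nat -> nat -> set R}.
Hypothesis scaleC : dyadic_scale C.

Let mC m k : measurable (C m k).
Proof. by case: scaleC => cC _ _; exact: closed_measurable. Qed.

Lemma dyadic_scale_refine j m k : C (j + m) (2 ^ j * k) = C m k.
Proof.
have [_ refineC _] := scaleC.
elim: j => [|j IH]; first by rewrite mul1n.
by rewrite addSn expnS -mulnA mul2n refineC.
Qed.

(** Both sets occur at the common level [m + m'], where the indices are compared
    and one climbs from one set to the other in unit steps. *)
Lemma dyadic_scale_lt m k m' k' :
  (k * 2 ^ m' < k' * 2 ^ m)%N -> density_subset (C m k) (C m' k').
Proof.
have [_ _ stepC] := scaleC.
rewrite -(dyadic_scale_refine m' m) -(dyadic_scale_refine m m') (addnC m').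
rewrite (mulnC k) (mulnC k').
move: (m + m')%N (2 ^ m' * k)%N (2 ^ m * k')%N => n i l.
elim: l => // l IH; rewrite ltnS leq_eqVlt => /orP[/eqP->//|/IH il].
by apply: density_subset_trans il (stepC _ _).
Qed.

(** A decreasing function of [k / 2 ^+ m], so that larger values go with smaller
    sets, with values in (0, 1]. *)
Definition dyadic_value m k : R := (1 + k%:R / 2 ^+ m)^-1.

Let ratio_ge0 m k : 0 <= k%:R / 2 ^+ m :> R.
Proof. by rewrite divr_ge0// exprn_ge0. Qed.

Let den_gt0 m k : 0 < 1 + k%:R / 2 ^+ m :> R.
Proof. exact: ltr_pwDl. Qed.

Let value_gt0 m k : 0 < dyadic_value m k.
Proof. by rewrite invr_gt0. Qed.

Let value_le1 m k : dyadic_value m k <= 1.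
Proof. by rewrite invf_le1// lerDl. Qed.

Lemma dyadic_scale_value_lt m k m' k' :
  dyadic_value m' k' < dyadic_value m k -> density_subset (C m k) (C m' k').
Proof.
rewrite /dyadic_value ltf_pV2 ?posrE// ltrD2l => h.
apply: dyadic_scale_lt.
move: h; rewrite ltr_pdivrMr ?exprn_gt0// mulrAC ltr_pdivlMr ?exprn_gt0//.
by rewrite -!natrX -!natrM ltr_nat.
Qed.

Lemma dyadic_value_between a b : 0 <= a -> a < b -> b <= 1 ->
  exists m k, a < dyadic_value m k < b.
Proof.
move=> a0 ab b1.
have b0 : 0 < b by exact: le_lt_trans ab.
(* [a] may be zero: the midpoint [c] can be inverted instead. *)
pose c := (a + b) / 2.
have [c0 ac cb] : [/\ 0 < c, a < c & c < b] by rewrite /c; split; lra.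
have s0 : 0 <= b^-1 - 1 by rewrite subr_ge0 invf_ge1.
have st : 0 < c^-1 - b^-1 by rewrite subr_gt0 ltf_pV2.
have [m hm] := exists_half_expr_lt st.
have p0 : 0 < 2 ^+ m :> R by rewrite exprn_gt0.
exists m, (Num.trunc ((b^-1 - 1) * 2 ^+ m)).+1.
have /andP[h1 h2] := truncn_itv (mulr_ge0 s0 (ltW p0)).
have k1 : b^-1 - 1 < (Num.trunc ((b^-1 - 1) * 2 ^+ m)).+1%:R / 2 ^+ m.
  by rewrite ltr_pdivlMr.
have k2 : (Num.trunc ((b^-1 - 1) * 2 ^+ m)).+1%:R / 2 ^+ m < c^-1 - 1.
  rewrite ltr_pdivrMr// -natr1.
  have : 1 < (c^-1 - b^-1) * 2 ^+ m by rewrite -ltr_pdivrMr// div1r -exprVn.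
  by move: h1; lra.
move: (Num.trunc _).+1 k1 k2 => k k1 k2; apply/andP; split.
  apply: (lt_trans ac); rewrite -[ltLHS]invrK ltf_pV2 ?posrE ?invr_gt0//.
  by lra.
rewrite -[ltRHS]invrK ltf_pV2 ?posrE ?invr_gt0//; lra.
Qed.

(** The value zero makes the supremum defined, and equal to zero, at the points that
    no set of the scale contains. *)
Definition scale_values x : set R :=
  [set 0] `|` [set dyadic_value mk.1 mk.2 | mk in [set mk | C mk.1 mk.2 x]].

Definition scale_function x : R := sup (scale_values x).

Let has_sup_values x : has_sup (scale_values x).
Proof.
by split; [exists 0; left|exists 1 => _ [->//|[mk _ <-]]].
Qed.

Lemma scale_function_ge m k x : C m k x -> dyadic_value m k <= scale_function x.
Proof.
by move=> Cx; apply: sup_upper_bound => //; right; exists (m, k).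
Qed.

Lemma scale_function_ge0 x : 0 <= scale_function x.
Proof. by apply: sup_upper_bound => //; left. Qed.

Lemma scale_function_le1 x : scale_function x <= 1.
Proof.
apply: sup_le_ub; first by exists 0; left.
by move=> _ [->//|[mk _ <-]].
Qed.

Lemma scale_function_gt u x : 0 <= u -> u < scale_function x ->
  exists m k, C m k x /\ u < dyadic_value m k.
Proof.
move=> u0 /(sup_gt (has_sup_values x).1)[_ [->|[[m k] /= Cx <-]] ux].
  by move: ux; rewrite ltNge u0.
by exists m, k.
Qed.

Lemma scale_function_gt0 x : (exists k, C 0 k x) <-> 0 < scale_function x.
Proof.
split=> [[k Cx]|]; first exact: lt_le_trans (scale_function_ge Cx).
move=> /scale_function_gt[//|m [k [Cx _]]]; exists k.+1.
have [|+ _] := @dyadic_scale_lt m k 0 k.+1; last exact.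
by rewrite muln1 (@leq_ltn_trans (k * 2 ^ m))// ?leq_pmulr ?ltn_pmul2r ?expn_gt0.
Qed.

(** Take a value [v] of the scale strictly between [scale_function x] and [c]: its
    set is closed and does not contain [x], and outside this set the function
    is at most [v]. *)
Lemma scale_function_usc x c : scale_function x < c ->
  \forall y \near x, scale_function y < c.
Proof.
move=> gc; have [c1|c1] := ltP 1 c.
  by near=> y; exact: le_lt_trans (scale_function_le1 y) c1.
have [m [k /andP[gv vc]]] := dyadic_value_between (scale_function_ge0 x) gc c1.
have nCx : ~ C m k x by move=> /scale_function_ge; rewrite leNgt gv.
have [cC _ _] := scaleC.
have nearC : nbhs x (~` C m k).
  by apply: open_nbhs_nbhs; split => //; exact: closed_openC.
near=> y; rewrite (le_lt_trans _ vc)// leNgt; apply/negP.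
move=> /(scale_function_gt (ltW (value_gt0 m k)))[m' [k' [Cy vlt]]].
have nCy : (~` C m k) y by near: y.
by apply: nCy; have [+ _] := dyadic_scale_value_lt vlt; exact.
Unshelve. all: by end_near. Qed.

(** Take two values of the scale with [u < v' < v <= scale_function x], where [x] lies
    in the set of [v].  This set is density-contained in the set of [v'], on
    which the function is at least [v']. *)
Lemma scale_function_density x u : 0 < scale_function x -> u < scale_function x ->
  exists F, [/\ measurable F, F x, density_point F x &
    forall y, F y -> u < scale_function y].
Proof.
move=> g0 ug; pose b := Num.max u 0.
have b0 : 0 <= b by rewrite le_max lexx orbT.
have bg : b < scale_function x by rewrite gt_max ug g0.
have [m [k [Cx bv]]] := scale_function_gt b0 bg.
have [m' [k' /andP[bv' vv]]] := dyadic_value_between b0 bv (value_le1 m k).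
have [CC dC] := dyadic_scale_value_lt vv.
exists (C m' k'); split => //; [exact: CC|exact: dC|].
move=> y /scale_function_ge; apply: lt_le_trans; apply: le_lt_trans bv'.
by rewrite le_max lexx.
Qed.

End DyadicScale.

(** * Limits along an ideal *)

Lemma ideal_bounded_index (I : set (set nat)) :
  is_ideal I -> admissible_ideal I -> forall n, I [set k | (k < n)%N].
Proof.
move=> [[A IA] IU IS] adm; elim=> [|n IH].
  by apply: IS IA => k; rewrite /= ltn0.
apply: IS (IU _ _ IH (adm n)) => k /=; rewrite ltnS leq_eqVlt => /orP[/eqP->|]; first by right.
by left.
Qed.

Section IdealLimits.
Context {R : realType} {I : set (set nat)}.
Hypotheses (I_ideal : is_ideal I) (I_proper : ~ I setT).
Variable x : nat -> R.
Hypothesis x01 : forall k, 0 <= x k <= 1.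

Let I0 : I set0.
Proof. by case: I_ideal => [[A IA] _ IS]; apply: IS IA. Qed.

Let liminf_set_ge0 a : ~ I [set k | x k < a] -> 0 <= a.
Proof.
apply: contra_notP => /negP; rewrite -ltNge => a0.
rewrite (_ : [set k | _] = set0)// -subset0 => k /= xa.
by have /andP[+ _] := x01 k; rewrite leNgt (lt_trans xa).
Qed.

Let limsup_set_le1 b : ~ I [set k | b < x k] -> b <= 1.
Proof.
apply: contra_notP => /negP; rewrite -ltNge => b1.
rewrite (_ : [set k | _] = set0)// -subset0 => k /= xb.
by have /andP[_] := x01 k; rewrite leNgt (lt_trans b1).
Qed.

Lemma ideal_liminf_le a : ~ I [set k | x k < a] -> ideal_liminf I x <= a.
Proof. by move=> Ia; apply: ge_inf => //; exists 0 => b /liminf_set_ge0. Qed.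

Lemma ideal_liminf_ge c : (forall a, a < c -> I [set k | x k < a]) ->
  c <= ideal_liminf I x.
Proof.
move=> h; apply: lb_le_inf.
  exists 2 => /=; rewrite (_ : [set k | _] = setT)//.
  by apply/seteqP; split => // k _ /=; have /andP[_ /le_lt_trans->] := x01 k; rewrite ?ltr1n.
by move=> a /= nI; rewrite leNgt; apply/negP => /h.
Qed.

Lemma ideal_liminf_ge0 : 0 <= ideal_liminf I x.
Proof.
apply: ideal_liminf_ge => a a0; apply: contrapT => /liminf_set_ge0.
by rewrite leNgt a0.
Qed.

Lemma ideal_lim_eq1 : (forall a, a < 1 -> I [set k | x k < a]) ->
  ideal_limsup I x = 1 /\ ideal_liminf I x = 1.
Proof.
have [_ IU IS] := I_ideal.
move=> h; split; apply/eqP; rewrite eq_le; apply/andP; split.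
- apply: sup_le_ub; last by move=> b /limsup_set_le1.
  exists (-1) => /=; rewrite (_ : [set k | _] = setT)//.
  apply/seteqP; split => // k _ /=; have /andP[+ _] := x01 k.
  by apply: lt_le_trans; rewrite ltrN10.
- apply/ler_addgt0Pr => e e0; rewrite -lerBlDr.
  apply: ub_le_sup; first by exists 1 => b /limsup_set_le1.
  move=> /= Ib; apply: I_proper.
  have e2 : 1 - e / 2 < 1 by lra.
  apply: IS (IU _ _ Ib (h _ e2)) => k _ /=.
  by have [?|?] := ltP (1 - e) (x k); [left|right; lra].
- apply/ler_addgt0Pr => e e0; apply: ideal_liminf_le.
  rewrite (_ : [set k | _] = setT)//; apply/seteqP; split => // k _ /=.
  by have /andP[_] := x01 k; lra.
- exact: ideal_liminf_ge.
Qed.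

End IdealLimits.

(** * Ideal density and classical density *)

Lemma lebE (R : realType) (A : set R) : leb A = lebesgue_measure A.
Proof. by []. Qed.

Lemma density_ratio_itv01 (R : realType) (E : set R) (J : nat -> set R) n :
  measurable E -> measurable (J n) -> 0 <= density_ratio E J n <= 1.
Proof.
move=> mE mJ; rewrite /density_ratio.
have [Jfin|Jy] := ltP (leb (J n)) +oo%E; last first.
  have /eqP -> : leb (J n) == +oo%E by rewrite -leye_eq.
  by rewrite /= invr0 mulr0 lexx ler01.
have [_ _ ] := lebesgue_split mJ mE Jfin; rewrite -/(leb _) => ->.
have d0 : 0 <= fine (leb (J n `\` E)) by exact: fine_ge0.
have i0 : 0 <= fine (leb (J n `&` E)) by exact: fine_ge0.
rewrite divr_ge0 ?addr_ge0//=.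
have [->|i1] := eqVneq (fine (leb (J n `&` E))) 0; first by rewrite mul0r.
by rewrite ler_pdivrMr ?mul1r ?lerDr// ltr_wpDl// lt_neqAle eq_sym i1.
Qed.

Lemma lebesgue_measure_segment (R : realType) (a b : R) : a <= b ->
  lebesgue_measure `[a, b]%classic = (b - a)%:E.
Proof.
rewrite lebesgue_measure_itv /= lte_fin le_eqVlt => /orP[/eqP->|->].
  by rewrite ltxx subrr.
by rewrite -EFinB.
Qed.

Lemma interval_sub_ball (R : realType) (J : set R) (p l : R) :
  measurable J -> is_interval J -> J p -> 0 < l ->
  leb J = l%:E -> J `<=` ball p (l *+ 2).
Proof.
move=> mJ iJ Jp l0 Jl y Jy; rewrite /ball/=.
suff : `|p - y| <= l by move/le_lt_trans; apply; rewrite mulr2n ltrDl.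
have seg a b : J a -> J b -> a <= b -> b - a <= l.
  move=> Ja Jb ab; rewrite -lee_fin -lebesgue_measure_segment// -Jl.
  apply: le_lebesgue => // z; rewrite /= in_itv/=; exact: iJ.
by rewrite ler_norml; have [py|/ltW yp] := leP p y; have := seg _ _ _ _ _ => h;
  [have := h _ _ Jp Jy py|have := h _ _ Jy Jp yp]; lra.
Qed.

Section IdealDensity.
Context {R : realType} {I : set (set nat)}.
Hypotheses (I_ideal : is_ideal I) (I_nontrivial : nontrivial_ideal I).

Let ratio01 (E : set R) p J : measurable E -> shrinking_at I p J ->
  forall k, 0 <= density_ratio E J k <= 1.
Proof.
move=> mE [cJ _ _] k; apply: density_ratio_itv01 => //.
by have [cl _] := cJ k; exact: closed_measurable.
Qed.

Let shrinking_segments (p : R) (a b : nat -> R) :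
  (forall n, [/\ a n <= p <= b n, a n < b n & b n - a n < n.+1%:R^-1]) ->
  shrinking_at I p (fun n => `[a n, b n]%classic).
Proof.
move=> ab; split => [n|n|].
- by split; [exact: itv_closed|exact: interval_is_interval].
- by have [apb _ _] := ab n; rewrite /= in_itv.
- rewrite /dual_filter /= (_ : ~` _ = set0).
    by have [[A IA] _ IS] := I_ideal; apply: IS IA.
  rewrite -subset0 => n /=; apply; have [_ abn ablt] := ab n.
  rewrite !lebE lebesgue_measure_segment ?ltW// !lte_fin.
  by rewrite subr_gt0 abn.
Qed.

(** Once [n] is large and [J n] is a short nondegenerate interval, it lies in a small
    ball of radius twice its length, so the ratio exceeds any [a < 1].  The
    excluded indices lie in the ideal, finitely many of them by admissibility
    and the others by the assumption on [J]; so all the upper and lower limits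
    are one. *)
Lemma density_point_has_density (E : set R) (p : R) :
  admissible_ideal I ->
  measurable E -> density_point E p -> has_density I p E 1.
Proof.
move=> adm mE dE.
have lim1 J : shrinking_at I p J ->
    ideal_limsup I (density_ratio E J) = 1 /\
    ideal_liminf I (density_ratio E J) = 1.
  move=> shJ; have r01 := ratio01 mE shJ; have [cJ Jp JI] := shJ.
  apply: (ideal_lim_eq1 I_ideal I_nontrivial.2 r01) => a a1.
  have e0 : 0 < (1 - a) / 2 by lra.
  have [d /= d0 dP] := dE _ e0.
  have [n0 n0d] : exists n0 : nat, 2 / d < n0%:R.
    by exists (Num.bound (2 / d)); apply: archi_boundP; rewrite divr_ge0// ltW.
  have [_ IU IS] := I_ideal.
  apply: IS (IU _ _ JI (ideal_bounded_index I_ideal adm n0)) => n /= ra.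
  have [|n0n] := ltnP n n0; [by right|left => /andP[J0 Jn]].
  have [cl iJ] := cJ n; have mJ := closed_measurable cl.
  have Jfin : (leb (J n) < +oo)%E by apply: lt_trans Jn _; exact: ltry.
  have Jl : leb (J n) = (fine (leb (J n)))%:E.
    by rewrite fineK// ge0_fin_numE// ltW.
  have [Dfin _ split_J] := lebesgue_split mJ mE Jfin.
  move: J0 Jn ra split_J; rewrite /density_ratio -!lebE Jl !lte_fin.
  move l_def : (fine (leb (J n))) Jl => l Jl l0 ln + split_J.
  rewrite ltr_pdivrMr// => ra.
  have ballE : (lebesgue_measure (ball p (l *+ 2) `\` E) <= ((1 - a) / 2 * (l *+ 2))%:E)%E.
    apply: dP; last by rewrite mulrn_wgt0.
    rewrite /ball_ /= sub0r normrN gtr0_norm ?mulrn_wgt0//.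
    have n0n' : n0%:R <= n.+1%:R :> R by rewrite ler_nat ltnW.
    have : 2 / d < n.+1%:R by exact: lt_le_trans n0n'.
    rewrite ltr_pdivrMr// => h.
    have : l * n.+1%:R < 1 by rewrite -ltr_pdivlMr// div1r.
    have : 0 < n.+1%:R :> R by [].
    move: h; move: n.+1%:R => N; nra.
  have : (lebesgue_measure (J n `\` E) <= ((1 - a) / 2 * (l *+ 2))%:E)%E.
    apply: le_trans ballE; apply: le_lebesgue; [exact: measurableD..|].
    by apply: setSD; exact: interval_sub_ball.
  rewrite -(fineK Dfin) lee_fin.
  have -> : (1 - a) / 2 * (l *+ 2) = l - a * l by rewrite mulr2n; field.
  by move: split_J ra; rewrite !lebE /=; lra.
(* The upper and lower densities are extrema of a nonempty family. *)
have [J0 shJ0] : exists J, shrinking_at I p J.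
  exists (fun n => `[p, p + n.+2%:R^-1]%classic); apply: shrinking_segments => n.
  have n2 : 0 < n.+2%:R^-1 :> R by rewrite invr_gt0.
  split; [by rewrite lexx lerDl ltW|by rewrite ltrDl|].
  by rewrite addrAC subrr add0r ltf_pV2 ?posrE// ltr_nat.
split.
- rewrite /upper_density (_ : [set _ | _ in _] = [set 1]) ?sup1//.
  apply/seteqP; split => [_ [J /lim1[-> _] <-]//|_ ->].
  by exists J0 => //; have [] := lim1 _ shJ0.
- rewrite /lower_density (_ : [set _ | _ in _] = [set 1]) ?inf1//.
  apply/seteqP; split => [_ [J /lim1[_ ->] <-]//|_ ->].
  by exists J0 => //; have [] := lim1 _ shJ0.
Qed.

(** If the classical density fails, there are arbitrarily short segments around [p]
    in which the proportion of [E] is at most [1 - e / 2].  Along them the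
    ratio is below [1 - e / 4] for every index, so the lower limit is
    below one for any proper ideal. *)
Lemma has_density_density_point (E : set R) (p : R) :
  measurable E -> has_density I p E 1 -> density_point E p.
Proof.
move=> mE [_ low1] e e0; apply: contrapT => nd.
have /choice[r rP] n : exists r : R, [/\ 0 < r, r *+ 2 < n.+1%:R^-1 &
    ~ (lebesgue_measure (ball p r `\` E) <= (e * r)%:E)%E].
  apply: contrapT => /forallNP nr; apply: nd; near=> r.
  apply: contrapT => hr; apply: (nr r); split => //.
  rewrite -(mulr_natr r 2) -ltr_pdivlMr//; near: r; exact: nbhs_right_lt.
pose J n := `[p - r n, p + r n]%classic.
have shJ : shrinking_at I p J.
  apply: shrinking_segments => n; have [r0 rn _] := rP n.
  split; [by rewrite gerBl lerDl ltW|by rewrite ltrD2l gtrN|].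
  by rewrite (_ : _ - _ = r n *+ 2)// mulr2n; ring.
have : 1 <= ideal_liminf I (density_ratio E J).
  rewrite -low1; apply: ge_inf; last by exists J.
  exists 0 => _ [K shK <-].
  exact: (ideal_liminf_ge0 I_ideal I_nontrivial.2 (ratio01 mE shK)).
have : ideal_liminf I (density_ratio E J) <= 1 - e / 4.
  apply: (ideal_liminf_le I_ideal (ratio01 mE shJ)).
  rewrite (_ : [set k | _] = setT); first exact: I_nontrivial.2.
  apply/seteqP; split => // n _ /=; have [r0 _ /negP] := rP n.
  rewrite -ltNge => rE.
  have mJ : measurable (J n) by exact: measurable_itv.
  have Jl : lebesgue_measure (J n) = (r n *+ 2)%:E.
    rewrite lebesgue_measure_segment; last lra.
    by congr EFin; rewrite mulr2n; lra.
  have Jfin : (lebesgue_measure (J n) < +oo)%E by rewrite Jl ltry.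
  have [Dfin _ +] := lebesgue_split mJ mE Jfin.
  have : e * r n < fine (lebesgue_measure (J n `\` E)).
    rewrite -lte_fin fineK//; apply: (lt_le_trans rE).
    apply: le_lebesgue; [exact: measurableD..|].
    apply: setSD => y; rewrite /ball/= /J/= in_itv/= ltr_distlC => /andP[? ?].
    by rewrite !ltW.
  rewrite /density_ratio !lebE Jl/= ltr_pdivrMr; last first.
    by rewrite mulrn_wgt0.
  by rewrite mulr2n; nra.
lra.
Unshelve. all: by end_near. Qed.

End IdealDensity.

(** * Zahorski's theorem for the ideal density *)

Lemma measurable_lebesgue_measurable (R : realType) (E : set R) :
  measurable E -> lebesgue_measurable E.
Proof. exact: (@sub_caratheodory _ _ R (wlength (@idfun R))). Qed.

Theorem theorem7p2 (R : realType) (I : set (set nat))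
    (I_ideal : is_ideal I) (I_nontrivial : nontrivial_ideal I)
    (I_admissible : admissible_ideal I)
    (H : set R) (H_Fsigma : Fsigma H)
    (H_density : forall x, H x -> has_density I x H 1) :
  exists g : R -> R,
    [/\ forall x, ideal_approx_continuous_at I g x,
        forall x, H x -> 0 < g x <= 1 &
        forall x, ~ H x -> g x = 0].
Proof.
have mH : measurable H.
  have [F cF ->] := H_Fsigma.
  by apply: bigcupT_measurable => n; exact: closed_measurable.
have dH x : H x -> density_point H x.
  by move=> /H_density; exact: has_density_density_point.
have [C [scaleC HC]] := exists_dyadic_scale H_Fsigma dH.
pose g := @scale_function R C.
have g_gt0 x : H x <-> 0 < g x.
  rewrite -(scale_function_gt0 scaleC) HC.
  by split=> [[k _ Ck]|[k Ck]]; exists k.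
have g0 x : ~ H x -> g x = 0.
  move=> nHx; apply/eqP; rewrite eq_le scale_function_ge0 andbT leNgt.
  by apply/negP => /g_gt0.
exists g; split=> [x|x /g_gt0 ->|//]; last exact: scale_function_le1.
have [Hx|nHx] := pselect (H x); last first.
  (* [g] vanishes at [x] and is nonnegative and upper semicontinuous. *)
  exists setT; split => //.
  - exact: measurable_lebesgue_measurable.
  - apply: density_point_has_density => // e e0; near=> r.
    by rewrite setDT measure0 lee_fin mulr_ge0// ltW.
  - rewrite (g0 x nHx); apply/cvgrPdist_lt => e e0.
    have ge : g x < e by rewrite g0.
    have := scale_function_usc scaleC ge; rewrite -/g => gne.
    apply: cvg_within; near=> y.
    rewrite sub0r normrN ger0_norm ?scale_function_ge0//.
    by near: y.
have gx0 := (g_gt0 x).1 Hx.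
have ug n : g x - n.+1%:R^-1 < g x by rewrite ltrBlDr ltrDl invr_gt0.
have [E EP] := choice (fun n => scale_function_density scaleC gx0 (ug n)).
have mE n : measurable (E n) by have [] := EP n.
have Ex n : E n x by have [] := EP n.
have dE n : density_point (E n) x by have [] := EP n.
have [F [mF Fx dF FE]] := density_point_diagonal mE Ex dE.
exists F; split => //.
- exact: measurable_lebesgue_measurable.
- exact: density_point_has_density.
- apply/cvgrPdist_lt => e e0.
  have [n ne] : exists n, n.+1%:R^-1 < e.
    exists (Num.bound e^-1); rewrite invf_plt ?posrE//.
    apply: (@lt_trans _ _ (Num.bound e^-1)%:R); last by rewrite ltr_nat.
    by apply: archi_boundP; rewrite invr_ge0 ltW.
  have ge : g x < g x + e by rewrite ltrDl.
  have := scale_function_usc scaleC ge; rewrite -/g => gne.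
  have := FE n => FEn.
  rewrite near_withinE; near=> y => Fy.
  have gy : g y < g x + e by near: y.
  have Ey : E n y by move: Fy; near: y.
  have [_ _ _ /(_ y Ey)] := EP n; rewrite -/g => gy'.
  by rewrite ltr_distlC gy andbT (lt_trans _ gy')// ltrD2l ltrN2.
Unshelve. all: by end_near. Qed.
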